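(* Let $X$ be a compact, connected, oriented, smooth $4$-manifold and let $\sigma : X \to X$ be a Real structure on $X$. Suppose that $b_1(X)=0$ and that $\sigma$ is not free (i.e. $\sigma$ has a fixed point). Then the forgetful map $H^2_{\mathbb{Z}_2}(X;\mathbb{Z}_-) \to H^2(X;\mathbb{Z})$ is injective with image the set of $\alpha \in H^2(X;\mathbb{Z})$ such that $\sigma^*(\alpha) = -\alpha$.
   Context: Manifolds are without boundary. A Real structure on an oriented smooth $4$-manifold $X$ is an orientation preserving smooth involution $\sigma : X \to X$ ($\sigma^2 = \mathrm{id}$, $\sigma \neq \mathrm{id}$). $\mathbb{Z}_2 = \langle \sigma \rangle$ acts on $X$; $H^*_{\mathbb{Z}_2}(X;\mathbb{Z}_-)$ denotes Borel equivariant cohomology with coefficients in the equivariant local system $\mathbb{Z}_-$, i.e. the constant local system $\mathbb{Z}$ on which $\sigma$ acts as $-1$. Equivalently, it is the cohomology of $X \times_{\mathbb{Z}_2} E\mathbb{Z}_2$ with coefficients in the local system induced by the sign representation of $\mathbb{Z}_2$ on $\mathbb{Z}$. The forgetful map is restriction to the fibre $X$ of $X\times_{\mathbb{Z}_2}E\mathbb{Z}_2 \to B\mathbb{Z}_2$. *)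

(* Defs.v *)
From HB Require Import structures.
From mathcomp Require Import all_boot all_order all_algebra.
From mathcomp.multinomials Require Import freeg.
From mathcomp Require Import all_classical all_reals all_analysis.
From mathcomp Require Import zify lra fintype.
Set Implicit Arguments.
Unset Strict Implicit.
Unset Printing Implicit Defensive.
Import Order.TTheory GRing.Theory Num.Theory.
Import numFieldNormedType.Exports.

Local Open Scope classical_set_scope.
Local Open Scope ring_scope.
Local Open Scope quotient_scope.

(* Z / (B :&: Z) for two subgroups Z and B of an abelian group V. *)
Section Subquotient.
Variables (V : zmodType) (Z B : zmodClosed V).

Record cycle_of := Cycle { cycle_val : V; cycle_valP : cycle_val \in Z }.
HB.instance Definition _ := [isSub for cycle_val].
HB.instance Definition _ := [Choice of cycle_of by <:].
HB.instance Definition _ := [SubChoice_isSubZmodule of cycle_of by <:].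

Definition bounding : {pred cycle_of} := fun z => \val z \in B.

Lemma boundingE z : (z \in bounding) = (\val z \in B). Proof. by []. Qed.

Lemma bounding_closed : zmod_closed bounding.
Proof.
split=> [|x y]; rewrite !boundingE; first by rewrite raddf0 rpred0.
by move=> xB yB; rewrite raddfB rpredB.
Qed.
HB.instance Definition _ :=
  GRing.isZmodClosed.Build cycle_of bounding bounding_closed.

Definition subquot : zmodType := Quotient.quot bounding.

End Subquotient.

Section SubquotientMap.
Variables (V W : zmodType) (Z B : zmodClosed V) (Z' B' : zmodClosed W).
Variable f : {additive V -> W}.
Hypothesis fZ : forall v, v \in Z -> f v \in Z'.
Hypothesis fB : forall v, v \in B -> f v \in B'.

Definition cycle_map (z : cycle_of Z) : cycle_of Z' := Cycle (fZ (cycle_valP z)).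

Definition subquot_map (x : subquot Z B) : subquot Z' B' :=
  \pi_(subquot Z' B') (cycle_map (repr x)).

Lemma subquot_mapE z :
  subquot_map (\pi_(subquot Z B) z) = \pi_(subquot Z' B') (cycle_map z).
Proof.
apply/eqP; rewrite /subquot_map -Quotient.idealrBE boundingE raddfB /=.
rewrite -raddfB; apply: fB.
have := reprK (\pi_(subquot Z B) z) => /eqP; rewrite -Quotient.idealrBE.
by rewrite boundingE raddfB.
Qed.

End SubquotientMap.

Record cochainComplex := CochainComplex {
  cochain :> nat -> zmodType;
  codiff : forall n, {additive cochain n -> cochain n.+1};
  codiffK : forall n (c : cochain n), codiff n.+1 (codiff n c) = 0
}.

Record cochainMap (C D : cochainComplex) := CochainMap {
  cochain_map :> forall n, {additive C n -> D n};
  cochain_mapd : forall n (c : C n),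
    cochain_map n.+1 (codiff C n c) = codiff D n (cochain_map n c)
}.

Section Cohomology.
Variable C : cochainComplex.

Definition cocycle n : {pred C n} := [pred c | codiff C n c == 0].

Definition coboundary n : {pred C n} :=
  match n return {pred C n} with
  | 0 => [pred c | c == 0]
  | m.+1 => [pred c | `[< exists b, c = codiff C m b >]]
  end.

Lemma cocycle_closed n : zmod_closed (@cocycle n).
Proof.
split=> [|x y]; rewrite !inE ?raddf0// => /eqP x0 /eqP y0.
by rewrite raddfB x0 y0 subr0.
Qed.

Lemma coboundary_closed n : zmod_closed (@coboundary n).
Proof.
case: n => [|n]; split.
- by rewrite inE.
- by move=> x y; rewrite !inE => /eqP-> /eqP->; rewrite subr0.
- by apply/asboolP; exists 0; rewrite raddf0.
- move=> x y /asboolP[a ->] /asboolP[b ->]; apply/asboolP.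
  by exists (a - b); rewrite raddfB.
Qed.

HB.instance Definition _ n :=
  GRing.isZmodClosed.Build (C n) (@cocycle n) (@cocycle_closed n).
HB.instance Definition _ n :=
  GRing.isZmodClosed.Build (C n) (@coboundary n) (@coboundary_closed n).

Definition cohomology n : zmodType := subquot (@cocycle n) (@coboundary n).

End Cohomology.

Section CohomologyMap.
Variables (C D : cochainComplex) (f : cochainMap C D) (n : nat).

Lemma cocycle_map c : c \in @cocycle C n -> f n c \in @cocycle D n.
Proof. by rewrite !inE -cochain_mapd => /eqP->; rewrite raddf0. Qed.

Lemma coboundary_map c : c \in @coboundary C n -> f n c \in @coboundary D n.
Proof.
case: n c => [|m] c; first by rewrite !inE => /eqP->; rewrite raddf0.
move=> /asboolP[b ->]; apply/asboolP; exists (f m b); exact: cochain_mapd.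
Qed.

Definition cohomology_map : cohomology C n -> cohomology D n :=
  subquot_map (@coboundary D n) cocycle_map.

Lemma cohomology_mapE (z : cycle_of (@cocycle C n)) :
  cohomology_map (\pi_(cohomology C n) z) =
  \pi_(cohomology D n) (cycle_map cocycle_map z).
Proof. exact: subquot_mapE coboundary_map z. Qed.

End CohomologyMap.
Arguments cohomology_map {C D} f n.

(* Rank of an abelian group: r is the largest size of a Z-independent family. *)
Definition zfree (A : zmodType) n (v : 'I_n -> A) :=
  forall k : 'I_n -> int, \sum_i v i *~ k i = 0 -> forall i, k i = 0.

Definition has_rank (A : zmodType) (r : nat) :=
  (exists v : 'I_r -> A, zfree v) /\
  (forall s (v : 'I_s -> A), zfree v -> (s <= r)%N).

Section Simplex.
Variable R : realType.

Definition stdsimplex n : set 'rV[R]_n.+1 :=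
  [set x | (forall i, 0 <= x 0 i) /\ \sum_i x 0 i = 1].
Arguments stdsimplex : clear implicits.

(* The i-th face inclusion inserts a zero i-th barycentric coordinate. *)
Definition insert0 n (i : 'I_n.+2) (x : 'rV[R]_n.+1) : 'rV[R]_n.+2 :=
  \row_j (if unlift i j is Some k then x 0 k else 0).

Lemma insert0_stdsimplex n i x : stdsimplex n x -> stdsimplex n.+1 (insert0 i x).
Proof.
move=> [x0 x1]; split=> [j|]; first by rewrite mxE; case: unlift.
rewrite (bigD1_ord i) //= mxE unlift_none add0r -x1.
by apply: eq_bigr => k _; rewrite mxE liftK.
Qed.

Definition coface n (i : 'I_n.+2) (x : stdsimplex n) : stdsimplex n.+1 :=
  exist _ (insert0 i (\val x)) (mem_set (insert0_stdsimplex i (set_mem (valP x)))).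

Lemma insert0_continuous n (i : 'I_n.+2) : continuous (@insert0 n i).
Proof.
move=> x A [P nP PA].
have : nbhs x [set y : 'rV[R]_n.+1 | forall a b, P a b (insert0 i y a b)].
  exists (fun _ k => P ord0 (lift i k)) => [a k|y yP].
    by have := nP ord0 (lift i k); rewrite mxE liftK (ord1 a).
  move=> a j; rewrite mxE (ord1 a); case: unliftP => [k ->|->].
    exact: (yP ord0 k).
  by apply: nbhs_singleton; have := nP ord0 i; rewrite mxE unlift_none.
by apply: filterS => y; apply: PA.
Qed.

Lemma coface_continuous n i : continuous (@coface n i).
Proof.
apply: continuous_comp_initial => x.
apply: (continuous_comp (g := @insert0 n i)); first exact: initial_continuous.
exact: insert0_continuous.
Qed.
HB.instance Definition _ n i :=
  isContinuous.Build _ _ (@coface n i) (@coface_continuous n i).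

Lemma insert0E n (i : 'I_n.+2) (x : 'rV[R]_n.+1) j :
  insert0 i x 0 j = \sum_(k | lift i k == j) x 0 k.
Proof.
rewrite mxE; case: unliftP => [l ->|->].
  by under eq_bigl do rewrite (inj_eq lift_inj); rewrite big_pred1_eq.
by rewrite big_pred0 // => k; rewrite eq_sym (negbTE (neq_lift _ _)).
Qed.

(* The cosimplicial identities, in a form that treats both cases j < i and
   i <= j at once. *)
Definition swap_faces n (p : 'I_n.+3 * 'I_n.+2) : 'I_n.+3 * 'I_n.+2 :=
  (lift p.1 p.2, inord (unbump p.2 p.1)).

Lemma swap_faces2 n (p : 'I_n.+3 * 'I_n.+2) :
  (swap_faces p).2 = unbump p.2 p.1 :> nat.
Proof.
case: p => i j /=; rewrite inordK //; have := ltn_ord i; have := ltn_ord j.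
rewrite /unbump; case: ltnP => //=; lia.
Qed.

Lemma swap_facesK n : involutive (@swap_faces n).
Proof.
move=> p; have Ep := swap_faces2 p; have Ep' := swap_faces2 (swap_faces p).
rewrite [LHS]surjective_pairing [RHS]surjective_pairing; congr pair; apply/val_inj.
  change (bump (bump p.1 p.2) (swap_faces p).2 = p.1).
  rewrite Ep /bump /unbump; lia.
change ((swap_faces (swap_faces p)).2 = p.2 :> nat).
rewrite Ep' Ep /= /bump /unbump; lia.
Qed.

Lemma coface_swap n (p : 'I_n.+3 * 'I_n.+2) x :
  coface p.1 (coface p.2 x) = coface (swap_faces p).1 (coface (swap_faces p).2 x).
Proof.
apply/val_inj/rowP => m /=; have E := swap_faces2 p.
rewrite !insert0E; under eq_bigr do rewrite insert0E.
under [RHS]eq_bigr do rewrite insert0E.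
rewrite (exchange_big_dep predT) //= [RHS](exchange_big_dep predT) //=.
apply: eq_bigr => l _.
have sum1 k (f : 'I_k -> 'I_n.+3) h (a : R) :
    \sum_(j | (f j == m) && (h == j)) a = if f h == m then a else 0.
  case: ifPn => [fhm|fhm]; last first.
    by apply: big_pred0 => j; have [<-|] := eqVneq h j; rewrite ?(negbTE fhm) ?andbF.
  by rewrite (big_pred1 h) // => j /=; case: (eqVneq h j) => [<-|_]; rewrite ?fhm ?andbF.
rewrite !sum1; suff -> : lift p.1 (lift p.2 l) =
    lift (lift p.1 p.2) (lift (inord (unbump p.2 p.1)) l) by [].
by apply/ord_inj => /=; rewrite bumpC -[in LHS]E.
Qed.

End Simplex.
Arguments stdsimplex : clear implicits.

Section Singular.
Variables (R : realType) (X : topologicalType).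

Definition singular n := continuousType (stdsimplex R n) X.

Definition face n (i : 'I_n.+2) (s : singular n.+1) : singular n :=
  s \o @coface R n i.

Definition singular_diff n (c : singular n -> int) : singular n.+1 -> int :=
  fun s => \sum_(i < n.+2) (-1) ^+ i * c (face i s).

Lemma singular_diff_additive n : zmod_morphism (@singular_diff n).
Proof.
move=> c d; apply/funext => s.
rewrite -[RHS]/(\sum_(i < n.+2) _ - \sum_(i < n.+2) _) -sumrB.
by apply: eq_bigr => i _; exact: mulrBr.
Qed.
HB.instance Definition _ n := GRing.isZmodMorphism.Build
  _ _ (@singular_diff n) (@singular_diff_additive n).

Lemma singular_diffK n (c : singular n -> int) :
  singular_diff (singular_diff c) = 0.
Proof.
apply/funext => s; rewrite [RHS]/GRing.zero/= /singular_diff.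
pose F (p : 'I_n.+3 * 'I_n.+2) : int :=
  (-1) ^+ (p.1 + p.2)%N * c (face p.2 (face p.1 s)).
transitivity (\sum_p F p).
  rewrite -(pair_bigA _ (fun i j => F (i, j))) /=; apply: eq_bigr => i _.
  by rewrite mulr_sumr; apply: eq_bigr => j _; rewrite mulrA -exprD.
have : \sum_p F p = - \sum_p F p.
  rewrite {1}(reindex_inj (inv_inj (@swap_facesK n))) -sumrN.
  apply: eq_bigr => p _; rewrite /F.
  have -> : face (swap_faces p).2 (face (swap_faces p).1 s) =
            face p.2 (face p.1 s).
    by apply/continuousEP => x /=; rewrite -coface_swap.
  rewrite swap_faces2 -mulNr; congr (_ * _).
  rewrite -signr_odd -[in RHS]signr_odd -signrN; congr (_ ^+ nat_of_bool _).
  rewrite /= /bump /unbump; lia.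
lia.
Qed.

Definition singular_cochains : cochainComplex :=
  CochainComplex singular_diffK.

Definition boundary n (c : {freeg (singular n.+1)}) : {freeg (singular n)} :=
  fglift (fun s => \sum_(i < n.+2) (-1) ^+ i *: << face i s >>) c.

Lemma boundary_additive n : zmod_morphism (@boundary n).
Proof. exact: lift_is_additive. Qed.
HB.instance Definition _ n := GRing.isZmodMorphism.Build
  _ _ (@boundary n) (@boundary_additive n).

Definition singular_cycle n : {pred {freeg (singular n)}} :=
  match n return {pred {freeg (singular n)}} with
  | 0 => predT
  | m.+1 => [pred c | boundary c == 0]
  end.

Definition singular_boundary n : {pred {freeg (singular n)}} :=
  [pred c | `[< exists b, c = boundary b >]].

Lemma singular_cycle_closed n : zmod_closed (@singular_cycle n).
Proof.
case: n => [|n]; split=> //; first by rewrite inE raddf0.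
by move=> x y; rewrite !inE => /eqP x0 /eqP y0; rewrite raddfB /= x0 y0 subr0.
Qed.

Lemma singular_boundary_closed n : zmod_closed (@singular_boundary n).
Proof.
split; first by apply/asboolP; exists 0; rewrite raddf0.
move=> x y /asboolP[a ->] /asboolP[b ->]; apply/asboolP.
by exists (a - b); rewrite raddfB.
Qed.

HB.instance Definition _ n := GRing.isZmodClosed.Build
  {freeg (singular n)} (@singular_cycle n) (@singular_cycle_closed n).
HB.instance Definition _ n := GRing.isZmodClosed.Build
  {freeg (singular n)} (@singular_boundary n) (@singular_boundary_closed n).

Definition singular_homology n : zmodType :=
  subquot (@singular_cycle n) (@singular_boundary n).

Definition has_betti n b := has_rank (singular_homology n) b.

End Singular.

Section Pullback.
Variables (R : realType) (X Y : topologicalType) (f : continuousType X Y).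

Definition pullback_cochain n (c : singular_cochains R Y n) :
  singular_cochains R X n := fun s => c (f \o s).

Lemma pullback_cochain_additive n : zmod_morphism (@pullback_cochain n).
Proof. by []. Qed.
HB.instance Definition _ n := GRing.isZmodMorphism.Build
  _ _ (@pullback_cochain n) (@pullback_cochain_additive n).

Lemma pullback_cochaind n (c : singular_cochains R Y n) :
  pullback_cochain (codiff _ n c) = codiff _ n (pullback_cochain c).
Proof.
apply/funext => s; apply: eq_bigr => i _; congr (_ * c _).
exact/continuousEP.
Qed.

Definition pullback n := cohomology_map (CochainMap pullback_cochaind) n.

End Pullback.
Arguments pullback R {X Y} f n.

Section Smooth.
Variable R : realType.

Fixpoint Ck k m n (V : set 'rV[R]_m) (f : 'rV[R]_m -> 'rV[R]_n) : Prop :=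
  match k with
  | 0 => {in V, continuous f}
  | k.+1 => {in V, forall p, differentiable f p} /\ forall v, Ck k V ('D_v f)
  end.

Definition smooth_on m n (V : set 'rV[R]_m) (f : 'rV[R]_m -> 'rV[R]_n) :=
  forall k, Ck k V f.

(* A homeomorphism from an open subset of X onto an open subset of R^n; the two
   maps are meaningful only on chart_dom and chart_cod. *)
Record chart (X : topologicalType) n := Chart {
  chart_dom : set X;
  chart_cod : set 'rV[R]_n;
  chart_to : X -> 'rV[R]_n;
  chart_from : 'rV[R]_n -> X;
  chart_dom_open : open chart_dom;
  chart_cod_open : open chart_cod;
  chart_to_cod : {homo chart_to : x / chart_dom x >-> chart_cod x};
  chart_from_dom : {homo chart_from : p / chart_cod p >-> chart_dom p};
  chart_toK : {in chart_dom, cancel chart_to chart_from};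
  chart_fromK : {in chart_cod, cancel chart_from chart_to};
  chart_to_continuous : {in chart_dom, continuous chart_to};
  chart_from_continuous : {in chart_cod, continuous chart_from}
}.

Section LocalExpression.
Variables (X Y : topologicalType) (m n : nat) (f : X -> Y).
Variables (c : chart X m) (d : chart Y n).

Definition local_dom : set 'rV[R]_m :=
  chart_cod c `&` (f \o chart_from c) @^-1` chart_dom d.

Definition local_expr : 'rV[R]_m -> 'rV[R]_n :=
  chart_to d \o f \o chart_from c.

End LocalExpression.

(* Hausdorff second countable spaces with an oriented smooth atlas. Charts are
   modelled on open subsets of R^n, hence there is no boundary. *)
Record orientedManifold n := OrientedManifold {
  carrier :> topologicalType;
  carrier_hausdorff : hausdorff_space carrier;
  carrier_second_countable : @second_countable carrier;
  atlas : set (chart carrier n);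
  atlas_cover : forall x, exists2 c, atlas c & chart_dom c x;
  atlas_smooth : forall c d, atlas c -> atlas d ->
    smooth_on (local_dom idfun c d) (local_expr idfun c d);
  atlas_oriented : forall c d, atlas c -> atlas d ->
    {in local_dom idfun c d, forall p, 0 < \det ('J (local_expr idfun c d) p)}
}.

Definition smooth_map m n (M : orientedManifold m) (N : orientedManifold n)
    (f : M -> N) :=
  continuous f /\
  forall c d, @atlas m M c -> @atlas n N d ->
    smooth_on (local_dom f c d) (local_expr f c d).

Definition orientation_preserving n (M N : orientedManifold n) (f : M -> N) :=
  forall c d, @atlas n M c -> @atlas n N d ->
    {in local_dom f c d, forall p, 0 < \det ('J (local_expr f c d) p)}.

Record realStructure (X : orientedManifold 4) := RealStructure {
  involution :> X -> X;
  involution_smooth : smooth_map involution;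
  involution_oriented : orientation_preserving involution;
  involutionK : involutive involution;
  involution_neq_id : involution <> idfun
}.

HB.instance Definition _ (X : orientedManifold 4) (s : realStructure X) :=
  isContinuous.Build X X (involution s) (involution_smooth s).1.

End Smooth.

(* Cochains anti-invariant under an involution of Y. When the involution is
   free and properly discontinuous, Y is a regular double cover of its orbit
   space B and these are Hom_{Z[Z/2]}(C_*(Y), Z_-), whose cohomology is that of
   B with coefficients in the local system attached to the sign character. *)
Section Antiinvariant.
Variables (R : realType) (Y : topologicalType) (tau : continuousType Y Y).

Definition antiinvariant n : {pred singular_cochains R Y n} :=
  [pred c : singular R Y n -> int |
    `[< forall s : singular R Y n, c (tau \o s) = - c s >]].

Lemma antiinvariant_closed n : zmod_closed (@antiinvariant n).
Proof.
split=> [|c d]; first by apply/asboolP => s; rewrite oppr0.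
move=> /asboolP cP /asboolP dP; apply/asboolP => s.
by rewrite -[LHS]/(c _ - d _) cP dP -opprD.
Qed.
HB.instance Definition _ n :=
  GRing.isZmodClosed.Build _ (@antiinvariant n) (@antiinvariant_closed n).

Record twisted_cochain n := TwistedCochain {
  twisted_val : singular_cochains R Y n;
  twisted_valP : twisted_val \in @antiinvariant n
}.
HB.instance Definition _ n := [isSub for @twisted_val n].
HB.instance Definition _ n := [Choice of twisted_cochain n by <:].
HB.instance Definition _ n := [SubChoice_isSubZmodule of twisted_cochain n by <:].

Lemma antiinvariantd n (c : singular_cochains R Y n) :
  c \in @antiinvariant n -> codiff _ n c \in @antiinvariant n.+1.
Proof.
move=> /asboolP cP; apply/asboolP => s.
rewrite -[RHS]mulN1r mulr_sumr; apply: eq_bigr => i _.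
rewrite mulrCA; congr (_ * _); rewrite mulN1r -cP; congr (c _).
exact/continuousEP.
Qed.

Definition twisted_diff n (c : twisted_cochain n) : twisted_cochain n.+1 :=
  TwistedCochain (antiinvariantd (twisted_valP c)).

Lemma twisted_diff_additive n : zmod_morphism (@twisted_diff n).
Proof. by move=> c d; apply/val_inj; rewrite raddfB/= -raddfB. Qed.
HB.instance Definition _ n := GRing.isZmodMorphism.Build
  _ _ (@twisted_diff n) (@twisted_diff_additive n).

Lemma twisted_diffK n (c : twisted_cochain n) : twisted_diff (twisted_diff c) = 0.
Proof. by apply/val_inj; rewrite raddf0; exact: codiffK. Qed.

Definition twisted_cochains : cochainComplex := CochainComplex twisted_diffK.

End Antiinvariant.

(* A contractible space with a free, properly discontinuous action of Z/2. *)
Record universalZ2 (R : realType) := UniversalZ2 {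
  EZ2 :> topologicalType;
  antipode : EZ2 -> EZ2;
  antipode_continuous : continuous antipode;
  antipodeK : involutive antipode;
  antipode_free : forall e, exists2 U, open_nbhs e U &
    U `&` antipode @^-1` U = set0;
  EZ2_contractible : exists (h : EZ2 * R -> EZ2) (e0 : EZ2),
    [/\ {within setT `*` `[0, 1], continuous h},
        (forall e, h (e, 0) = e) & (forall e, h (e, 1) = e0)]
}.

(* The record is inhabited: R^N minus 0 in the product topology, with x |-> - x,
   contracted through the right shift. *)
Section UniversalZ2Exists.
Variable R : realType.
Local Notation seqR := (prod_topology (fun _ : nat => R)).

Definition nonzero_seq : set seqR := [set x | exists k, x k != 0].

Lemma neg_nonzero_seq (x : nonzero_seq) : nonzero_seq (fun k => - \val x k).
Proof. by case: (set_mem (valP x)) => k xk; exists k; rewrite oppr_eq0. Qed.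

Definition neg_seq (x : nonzero_seq) : nonzero_seq :=
  exist (fun y => y \in nonzero_seq) _ (mem_set (neg_nonzero_seq x)).

Definition contraction (p : nonzero_seq * R) (k : nat) : R :=
  let: (x, t) := p in
  Num.max (1 - 2 * t) 0 * \val x k +
  (if k is j.+1 then Num.max (1 - `|2 * t - 1|) 0 * \val x j
   else Num.max (2 * t - 1) 0).

Lemma contraction_nonzero p : nonzero_seq (contraction p).
Proof.
case: p => x t; apply: contrapT => h0.
have {h0} h0 k : contraction (x, t) k = 0.
  by apply: contrapT => hk; apply: h0; exists k; apply/eqP.
case: (set_mem (valP x)) => l; apply/negP/negPn/eqP.
have [t2|t2] := ltP (2 * t) 1.
  elim: l => [|l IHl].
    have := h0 0; rewrite /contraction /= (max_idPl _) ?(max_idPr _); [|lra|lra].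
    by rewrite addr0 => /eqP; rewrite mulf_eq0 => /orP[|] /eqP //; lra.
  have := h0 l.+1; rewrite /contraction /= IHl mulr0 addr0 (max_idPl _); last lra.
  by move=> /eqP; rewrite mulf_eq0 => /orP[|] /eqP //; lra.
have te : 2 * t - 1 = 0.
  by have := h0 0; rewrite /contraction /= (max_idPr _) ?(max_idPl _) ?mul0r ?add0r //; lra.
have := h0 l.+1; rewrite /contraction /= te normr0 subr0 (max_idPl ler01) mul1r.
by rewrite (max_idPr _) ?mul0r ?add0r //; lra.
Qed.

Definition contract (p : nonzero_seq * R) : nonzero_seq :=
  exist (fun y => y \in nonzero_seq) _ (mem_set (contraction_nonzero p)).

Lemma seq_continuous (T : topologicalType) (f : T -> nonzero_seq) :
  (forall k, continuous (fun x => \val (f x) k : R)) -> continuous f.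
Proof.
move=> fk; apply: continuous_comp_initial => x.
apply/cvg_sup => k; apply: (@continuous_comp_initial _ _ _ (fun y : seqR => y k) (fun x => \val (f x)) _ x).
exact: fk.
Qed.

Lemma coord_seq_continuous k : continuous (fun x : nonzero_seq => \val x k : R).
Proof.
move=> x; apply: (@continuous_comp _ seqR _ (fun x : nonzero_seq => \val x)
  (fun y : seqR => y k)).
  exact: initial_continuous.
exact: proj_continuous.
Qed.

Lemma neg_seq_continuous : continuous neg_seq.
Proof.
apply: seq_continuous => k x.
exact: (cvgN (coord_seq_continuous (k := k) (x := x))).
Qed.

Lemma contract_continuous : continuous contract.
Proof.
have max0 (g : R -> R) : continuous g -> continuous (fun t => Num.max (g t) 0).
  by move=> cg t; apply: continuous_max; [exact: cg | exact: cst_continuous].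
have lin : continuous (fun t : R => 2 * t - 1).
  by move=> t; apply: cvgB; [apply: cvgMr; exact: cvg_id | exact: cvg_cst].
have c1 := max0 _ lin.
have c2 : continuous (fun t : R => Num.max (1 - `|2 * t - 1|) 0).
  apply: max0 => t; apply: cvgB; first exact: cvg_cst.
  by apply: cvg_norm; exact: lin.
have c3 : continuous (fun t : R => Num.max (1 - 2 * t) 0).
  apply: max0 => t; apply: cvgB; first exact: cvg_cst.
  by apply: cvgMr; exact: cvg_id.
have csnd (g : R -> R) : continuous g ->
    continuous (fun p : nonzero_seq * R => g p.2).
  by move=> cg p; apply: continuous_comp; [exact: cvg_snd | exact: cg].
have cfst k : continuous (fun p : nonzero_seq * R => \val p.1 k : R).
  move=> p; apply: (@continuous_comp _ _ _ fst (fun x : nonzero_seq => \val x k : R)).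
    exact: cvg_fst.
  exact: coord_seq_continuous.
apply: seq_continuous => k.
rewrite (_ : (fun p => _) = (fun p : nonzero_seq * R =>
    Num.max (1 - 2 * p.2) 0 * \val p.1 k +
    (if k is j.+1 then Num.max (1 - `|2 * p.2 - 1|) 0 * \val p.1 j
     else Num.max (2 * p.2 - 1) 0))); last by apply/funext => -[].
move=> p; apply: cvgD.
  by apply: cvgM; [exact: (csnd _ c3) | exact: cfst].
case: k => [|k]; first exact: (csnd _ c1).
by apply: cvgM; [exact: (csnd _ c2) | exact: cfst].
Qed.

Lemma neg_seqK : involutive neg_seq.
Proof. by move=> x; apply/val_inj/funext => k /=; rewrite opprK. Qed.

Lemma neg_seq_free e : exists2 U, open_nbhs e U & U `&` neg_seq @^-1` U = set0.
Proof.
case: (set_mem (valP e)) => k ek.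
have [ek0|ek0] := ltP 0 (\val e k : R).
  exists [set x : nonzero_seq | 0 < (\val x k : R)].
    split=> //; apply: (@open_comp _ _ (fun x : nonzero_seq => \val x k : R) [set r | 0 < r]).
      by move=> x _; exact: coord_seq_continuous.
    exact: open_gt.
  by apply/seteqP; split=> // x [/= x0]; rewrite oppr_gt0 ltNge ltW.
exists [set x : nonzero_seq | (\val x k : R) < 0].
  split=> /=; last by rewrite lt_neqAle ek.
  apply: (@open_comp _ _ (fun x : nonzero_seq => \val x k : R) [set r | r < 0]).
    by move=> x _; exact: coord_seq_continuous.
  exact: open_lt.
by apply/seteqP; split=> // x [/= x0]; rewrite oppr_lt0 ltNge ltW.
Qed.

Lemma nonzero_seq_contractible : exists (h : nonzero_seq * R -> nonzero_seq) (e0 : nonzero_seq),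
    [/\ {within setT `*` `[0, 1], continuous h},
        (forall e, h (e, 0) = e) & (forall e, h (e, 1) = e0)].
Proof.
have n1 : nonzero_seq (fun k => (k == 0)%:R) by exists 0; rewrite eqxx oner_eq0.
exists contract, (exist (fun y => y \in nonzero_seq) _ (mem_set n1)); split.
- exact/continuous_subspaceT/contract_continuous.
- move=> e; apply/val_inj/funext => k /=.
  rewrite /contraction mulr0 subr0 sub0r normrN1 subrr maxxx (max_idPl _)//.
  rewrite mul1r; case: k => [|k]; rewrite ?mul0r ?addr0 //.
  by rewrite (max_idPr _) ?addr0 ?lerN10.
- move=> e; apply/val_inj/funext => k /=.
  rewrite /contraction mulr1 (max_idPr _) ?mul0r ?add0r; last lra.
  case: k => [|k] /=; first by rewrite (max_idPl _); lra.
  by rewrite ger0_norm ?(max_idPr _) ?mul0r //; lra.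
Qed.

Definition R_infty_minus_0 : universalZ2 R :=
  UniversalZ2 neg_seq_continuous neg_seqK neg_seq_free nonzero_seq_contractible.

End UniversalZ2Exists.

Section Borel.
Variables (R : realType) (X : orientedManifold R 4) (sigma : realStructure X).
Variable E : universalZ2 R.

Definition diagonal_involution (p : X * E) : X * E :=
  (sigma p.1, antipode p.2).

Lemma diagonal_involution_continuous : continuous diagonal_involution.
Proof.
move=> p; apply: cvg_pair => /=; apply: continuous_comp.
- exact: cvg_fst.
- exact: cts_fun.
- exact: cvg_snd.
- exact: antipode_continuous.
Qed.
HB.instance Definition _ :=
  isContinuous.Build _ _ diagonal_involution diagonal_involution_continuous.

Definition borel_cochains := twisted_cochains R diagonal_involution.

Definition fibre_inclusion (e : E) (x : X) : X * E := (x, e).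

Lemma fibre_inclusion_continuous e : continuous (fibre_inclusion e).
Proof. by move=> x; apply: cvg_pair; [exact: cvg_id | exact: cvg_cst]. Qed.
HB.instance Definition _ e :=
  isContinuous.Build _ _ (fibre_inclusion e) (@fibre_inclusion_continuous e).

Definition borel_restriction e n (c : borel_cochains n) :
  singular_cochains R X n := pullback_cochain (fibre_inclusion e) (val c).

Lemma borel_restriction_additive e n : zmod_morphism (@borel_restriction e n).
Proof. by move=> c d; rewrite /borel_restriction !raddfB. Qed.
HB.instance Definition _ e n := GRing.isZmodMorphism.Build
  _ _ (@borel_restriction e n) (@borel_restriction_additive e n).

Lemma borel_restrictiond e n (c : borel_cochains n) :
  borel_restriction e (codiff _ n c) = codiff _ n (borel_restriction e c).
Proof. exact: pullback_cochaind. Qed.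

(* Restriction to the fibre X x {e} of the Borel fibration, over the class of e. *)
Definition forgetful (e : E) n :
    cohomology borel_cochains n -> cohomology (singular_cochains R X) n :=
  cohomology_map (CochainMap (@borel_restrictiond e)) n.

End Borel.
Arguments borel_cochains {R X} sigma E.
Arguments forgetful {R X} sigma {E} e n.

(* Main.v *)
Require Import Defs.
From HB Require Import structures.
From mathcomp Require Import all_boot all_order all_algebra.
From mathcomp.multinomials Require Import freeg.
From mathcomp Require Import all_classical all_reals all_analysis.
From mathcomp Require Import zify ring fintype.
Import Order.TTheory GRing.Theory Num.Theory.
Import numFieldNormedType.Exports.
Local Open Scope classical_set_scope.
Local Open Scope ring_scope.
Local Open Scope quotient_scope.

(** Write Y for the product of X with E, tau for the diagonal involution of Y and
T for the action of tau on the cochains of Y. The proof does by hand, in degrees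
at most two, what the spectral sequence of the Borel fibration does in general.

Two facts reduce everything to cochains on Y. Since E is contractible,
restriction to a slice and pullback along the projection are inverse to each
other in cohomology, so H^n(Y) = H^n(X); this is the homotopy invariance of
singular cohomology, proved with the prism operator ([homotopic_cocycle]) and
used through [product_cocycle]. Since X is connected and covered by charts, its
points are joined by singular 1-chains ([manifold_linked]), hence 0-cocycles are
constant; and since H_1(X) has rank zero, every 1-cocycle vanishes on cycles and
is exact ([betti1_0_cocycle1_exact]). Both properties pass to Y.

Since tau is free on Y it is free on singular simplices, and a choice of one
simplex in each orbit shows that every T-invariant cochain has the form a + T a
and every T-anti-invariant one the form a - T a ([invariant_norm] and
[antiinvariant_norm]). In other words Z/2 has no higher cohomology with values in
cochains of Y.

Injectivity ([antiinvariant_primitive]): let c be anti-invariant and c = d b. Then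
b + T b is a cocycle, so it is d g; the cocycle g - T g is a constant k, and
applying T gives k = - k, so g is invariant, g = f + T f. Correcting b by - d f
makes it anti-invariant.

Image ([antiinvariant_representative]): let c + T c = d b. Then b - T b = d g and
g + T g is a constant. If this constant vanishes, g = f - T f, so b - d f is
invariant, hence of the form a + T a, and c - d a is anti-invariant. Since g can
be changed by a constant, only the parity of g + T g matters; it is the
obstruction in H^3(Z/2; Z_-) = Z/2. A fixed point x of the Real structure gives an
equivariant copy of E in Y; because E is acyclic, g restricts there to some f - T f
plus a constant m, so that g + T g = 2 m is even ([equivariant_point_parity]). *)

Set Implicit Arguments.
Unset Strict Implicit.
Unset Printing Implicit Defensive.

(** * Simplicial maps between standard simplices *)

Section VertexMaps.
Variable R : realType.

Lemma continuous_row (T : topologicalType) n (f : T -> 'rV[R]_n) x :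
  (forall j, {for x, continuous (fun y => f y 0 j)}) -> {for x, continuous f}.
Proof.
move=> fj A [P nP PA].
have : \forall y \near x, forall j, P 0 j (f y 0 j).
  by apply: filter_forall => j; exact: (fj j _ (nP 0 j)).
by apply: filterS => y Py; apply: PA => i j; rewrite (ord1 i).
Qed.

Lemma continuous_sum (T : topologicalType) (I : Type) (r : seq I) (P : pred I)
    (f : I -> T -> R) x : (forall i, {for x, continuous (f i)}) ->
  {for x, continuous (fun y => \sum_(i <- r | P i) f i y)}.
Proof.
move=> fi; apply: (@cvg_big _ _ +%R 0 P) => //; first exact: add_continuous.
by move=> i _; exact: fi.
Qed.

Lemma barycentric_continuous n (i : 'I_n.+1) :
  continuous (fun x : stdsimplex R n => \val x 0 i : R).
Proof.
move=> x; apply: (@continuous_comp _ 'rV[R]_n.+1 _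
  (fun x : stdsimplex R n => \val x) (fun M : 'rV[R]_n.+1 => M 0 i)).
  exact: initial_continuous.
exact: coord_continuous.
Qed.

Definition vertex_row m n (f : 'I_m.+1 -> 'I_n.+1) (x : 'rV[R]_m.+1) :
    'rV[R]_n.+1 := \row_j \sum_(i | f i == j) x 0 i.

Lemma sum_vertex_row m n (f : 'I_m.+1 -> 'I_n.+1) (P : pred 'I_n.+1) x :
  \sum_(j | P j) vertex_row f x 0 j = \sum_(i | P (f i)) x 0 i.
Proof.
under eq_bigr do rewrite mxE.
rewrite (partition_big f P) //=.
apply: eq_bigr => j Pj; apply: eq_bigl => i.
by case: eqVneq => [->|]; rewrite ?Pj ?andbF.
Qed.

Lemma vertex_row_stdsimplex m n (f : 'I_m.+1 -> 'I_n.+1) (x : stdsimplex R m) :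
  stdsimplex R n (vertex_row f (\val x)).
Proof.
have [x0 x1] := set_mem (valP x); split=> [j|]; first by rewrite mxE sumr_ge0.
by rewrite (sum_vertex_row f predT).
Qed.

(** The affine map between simplices that is given by f on vertices. Faces and
the projections of a prism onto its base are all of this form, so that their
compositions can be computed on vertices alone. *)
Definition vertex_map m n (f : 'I_m.+1 -> 'I_n.+1) (x : stdsimplex R m) :
    stdsimplex R n :=
  exist _ (vertex_row f (\val x)) (mem_set (vertex_row_stdsimplex f x)).

Lemma vertex_map_continuous m n (f : 'I_m.+1 -> 'I_n.+1) :
  continuous (vertex_map f).
Proof.
apply: continuous_comp_initial => x; apply: continuous_row => j.
rewrite (_ : (fun _ => _) =
    fun y : stdsimplex R m => \sum_(i | f i == j) \val y 0 i).
  apply: continuous_sum => i; exact: barycentric_continuous.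
by apply/funext => y; rewrite mxE.
Qed.

Lemma coface_vertex_map n (i : 'I_n.+2) : coface i =1 vertex_map (lift i).
Proof. by move=> x; apply/val_inj/rowP => j /=; rewrite insert0E mxE. Qed.

Lemma vertex_map_comp m n p (g : 'I_n.+1 -> 'I_p.+1) (f : 'I_m.+1 -> 'I_n.+1) x :
  vertex_map g (vertex_map f x) = vertex_map (g \o f) x.
Proof.
apply/val_inj/rowP => j; rewrite /= mxE.
by rewrite (sum_vertex_row f (fun i => g i == j)) mxE.
Qed.

Lemma vertex_map_id n (f : 'I_n.+1 -> 'I_n.+1) x : f =1 id -> vertex_map f x = x.
Proof.
move=> fid; apply/val_inj/rowP => j; rewrite mxE.
by under eq_bigl do rewrite fid; rewrite big_pred1_eq.
Qed.

(** The affine function equal to 1 on the vertices in g and to 0 on the others. *)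
Definition height n (g : pred 'I_n.+1) (x : stdsimplex R n) : R :=
  \sum_(i | g i) \val x 0 i.

Lemma height_continuous n (g : pred 'I_n.+1) : continuous (height g).
Proof. by move=> x; apply: continuous_sum => i; exact: barycentric_continuous. Qed.

Lemma height_vertex_map m n (f : 'I_m.+1 -> 'I_n.+1) g x :
  height g (vertex_map f x) = height (g \o f) x.
Proof. exact: sum_vertex_row. Qed.

End VertexMaps.

(** * Homotopy invariance of singular cohomology *)

Section PrismSimplices.
Variables (R : realType) (Y Z : topologicalType).
Variable H : continuousType (Y * R)%type Z.

Definition prism_fun m n (s : singular R Y n) (f : 'I_m.+1 -> 'I_n.+1)
  (g : pred 'I_m.+1) (x : stdsimplex R m) : Z := H (s (vertex_map f x), height g x).

Lemma prism_fun_continuous m n (s : singular R Y n) (f : 'I_m.+1 -> 'I_n.+1) g :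
  continuous (prism_fun s f g).
Proof.
move=> x; apply: (@continuous_comp _ (Y * R)%type _
   (fun x => (s (vertex_map f x), height g x)) H); last exact: cts_fun.
have sx : s (vertex_map f y) @[y --> x] --> s (vertex_map f x); last first.
  exact: (cvg_pair sx (@height_continuous R m g x)).
apply: (@continuous_comp _ _ _ (vertex_map f) s); last exact: cts_fun.
exact: vertex_map_continuous.
Qed.

HB.instance Definition _ m n s f g :=
  isContinuous.Build _ _ (@prism_fun m n s f g) (@prism_fun_continuous m n s f g).

(** The simplex of the prism over s whose i-th vertex lies above the vertex f i
of s, at the top of the prism if g i holds and at the bottom otherwise. *)
Definition prism_simplex m n (s : singular R Y n) (f : 'I_m.+1 -> 'I_n.+1)
  (g : pred 'I_m.+1) : singular R Z m := prism_fun s f g.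

Lemma face_prism m n (s : singular R Y n) (f : 'I_m.+2 -> 'I_n.+1) g i :
  face i (prism_simplex s f g) = prism_simplex s (f \o lift i) (g \o lift i).
Proof.
apply/continuousEP => x /=; rewrite /prism_fun coface_vertex_map.
by rewrite vertex_map_comp height_vertex_map.
Qed.

Lemma prism_face m n (s : singular R Y n.+1) (f : 'I_m.+1 -> 'I_n.+1) g i :
  prism_simplex (face i s) f g = prism_simplex s (lift i \o f) g.
Proof.
apply/continuousEP => x /=; rewrite /prism_fun /= coface_vertex_map.
by rewrite vertex_map_comp.
Qed.

Lemma eq_prism m n (s : singular R Y n) (f f' : 'I_m.+1 -> 'I_n.+1) g g' :
  f =1 f' -> g =1 g' -> prism_simplex s f g = prism_simplex s f' g'.
Proof. by move=> /funext -> /funext ->. Qed.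

End PrismSimplices.

Section PrismCancellation.
Local Open Scope nat_scope.

(** The combinatorics of the prism operator. F i k stands for the k-th face of the
i-th simplex of the prism, and K k i for the i-th simplex of the prism over the
k-th face. The side faces (k < i or k > i + 1) cancel against the prisms over the
faces; the inner faces k = i and k = i + 1 telescope, leaving only the top T 0 and
the bottom T n.+2. *)
Lemma prism_cancellation n (F K : nat -> nat -> int) (T : nat -> int) :
  (forall i k, k <= i <= n -> F i.+1 k = K k i) ->
  (forall i k, i < k <= n.+1 -> F i k.+1 = K k i) ->
  (forall i, i <= n.+1 -> F i i = T i) ->
  (forall i, i <= n.+1 -> F i i.+1 = T i.+1) ->
  (\sum_(i < n.+2) \sum_(k < n.+3) (-1) ^+ (i + k) * F i k +
   \sum_(k < n.+2) \sum_(i < n.+1) (-1) ^+ (k + i) * K k i = T 0 - T n.+2)%R.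
Proof.
move=> Flt Fgt Tl Tr.
pose S i := (\sum_(0 <= k < i) (-1) ^+ (i + k) * F i k)%R.
pose U i := (\sum_(i.+2 <= k < n.+3) (-1) ^+ (i + k) * F i k)%R.
have FE : (\sum_(i < n.+2) \sum_(k < n.+3) (-1) ^+ (i + k) * F i k =
   \sum_(0 <= i < n.+2) (T i - T i.+1) +
   (\sum_(0 <= i < n.+2) S i + \sum_(0 <= i < n.+2) U i))%R.
  rewrite -!big_split big_mkord; apply: eq_bigr => -[i /= ilt] _.
  rewrite -(big_mkord predT (fun k => ((-1) ^+ (i + k) * F i k)%R)).
  rewrite (big_cat_nat (n := i)) //=; last by lia.
  have i3 : i < n.+3 by lia.
  have i4 : i.+1 < n.+3 by lia.
  rewrite (big_ltn i3) (big_ltn i4) Tl // Tr //.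
  rewrite -signr_odd oddD addbb -[in (-1) ^+ (i + i.+1)]signr_odd oddD /=.
  by rewrite addbN addbb /= /S /U; ring.
have SE : (\sum_(0 <= i < n.+2) S i =
    - \sum_(0 <= i < n.+1) \sum_(0 <= k < i.+1) (-1) ^+ (k + i) * K k i)%R.
  rewrite big_nat_recl // [S 0]big_geq // add0r -sumrN.
  apply: eq_big_nat => i ilt; rewrite -sumrN; apply: eq_big_nat => k klt.
  by rewrite Flt; [rewrite addSn exprS mulN1r mulNr addnC | lia].
have UE : (\sum_(0 <= i < n.+2) U i =
    - \sum_(0 <= i < n.+1) \sum_(i.+1 <= k < n.+2) (-1) ^+ (k + i) * K k i)%R.
  rewrite big_nat_recr // [U n.+1]big_geq // /GRing.add /= addr0 -sumrN.
  apply: eq_big_nat => i ilt; rewrite -sumrN /U big_add1.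
  apply: eq_big_nat => k klt.
  by rewrite Fgt; [rewrite addnS exprS mulN1r mulNr addnC | lia].
have TE : (\sum_(0 <= i < n.+2) (T i - T i.+1) = T 0 - T n.+2)%R.
  rewrite (@telescope_sumr_eq _ _ _ (fun i => (- T i)%R)) //; first by ring.
  by move=> i _; ring.
have KE : (\sum_(k < n.+2) \sum_(i < n.+1) (-1) ^+ (k + i) * K k i =
    \sum_(0 <= i < n.+1) \sum_(0 <= k < i.+1) (-1) ^+ (k + i) * K k i +
    \sum_(0 <= i < n.+1) \sum_(i.+1 <= k < n.+2) (-1) ^+ (k + i) * K k i)%R.
  rewrite exchange_big -big_split big_mkord; apply: eq_bigr => -[i /= ilt] _.
  rewrite -(big_mkord predT (fun k => ((-1) ^+ (k + i) * K k i)%R)).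
  by rewrite (big_cat_nat (n := i.+1)) //=; lia.
by rewrite FE TE SE UE KE; ring.
Qed.

End PrismCancellation.

Section Homotopy.
Variables (R : realType) (Y Z : topologicalType).
Variable H : continuousType (Y * R)%type Z.

Definition time_slice t (y : Y) := H (y, t).

Lemma time_slice_continuous t : continuous (time_slice t).
Proof.
move=> y; apply: (@continuous_comp _ (Y * R)%type _ (fun y => (y, t)) H).
  exact: (cvg_pair cvg_id (cvg_cst t)).
exact: cts_fun.
Qed.
HB.instance Definition _ t :=
  isContinuous.Build _ _ (time_slice t) (@time_slice_continuous t).

Definition degeneracy n (i : nat) (j : 'I_n.+2) : 'I_n.+1 := inord (unbump i j).

(** The i-th simplex of the prism over s has the vertices 0, ..., i of the bottom,
followed by the vertices i, ..., n of the top. *)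
Definition prism_piece n (s : singular R Y n) i : singular R Z n.+1 :=
  prism_simplex H s (@degeneracy n i) (fun j : 'I_n.+2 => (i < j)%N).

Definition prism_operator n (c : singular R Z n.+1 -> int) : singular R Y n -> int :=
  fun s => \sum_(i < n.+1) (-1) ^+ i * c (prism_piece s i).

Lemma prism_ends n (s : singular R Y n) :
  (prism_simplex H s id (fun j : 'I_n.+1 => (0 <= j)%N) = time_slice 1 \o s) *
  (prism_simplex H s id (fun j : 'I_n.+1 => (n.+1 <= j)%N) = time_slice 0 \o s).
Proof.
split; apply/continuousEP => x.
all: rewrite /= /prism_fun /time_slice vertex_map_id // /height.
  by have [_ ->] := set_mem (valP x).
by rewrite big_pred0 // => i; rewrite leqNgt ltn_ord.
Qed.

Lemma prism_operatorE n (c : singular R Z n.+1 -> int) (s : singular R Y n.+1) :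
  c (time_slice 1 \o s) - c (time_slice 0 \o s) =
  prism_operator (singular_diff c) s + singular_diff (prism_operator c) s.
Proof.
rewrite -!(prism_ends s).
pose F i k := c (prism_simplex H s
  (fun j : 'I_n.+2 => inord (unbump i (bump k j))) (fun j => (i < bump k j)%N)).
pose K k i := c (prism_simplex H s
  (fun j : 'I_n.+2 => inord (bump k (unbump i j))) (fun j => (i < j)%N)).
pose T i := c (prism_simplex H s id (fun j : 'I_n.+2 => (i <= j)%N)).
transitivity (\sum_(i < n.+2) \sum_(k < n.+3) (-1) ^+ (i + k)%N * F i k +
              \sum_(k < n.+2) \sum_(i < n.+1) (-1) ^+ (k + i)%N * K k i).
  rewrite -[LHS]/(T 0 - T n.+2); apply/esym.
  apply: (@prism_cancellation n F K T) => [i k ik|i k ik|i ilt|i ilt];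
    congr c; apply: eq_prism => j; rewrite /bump /unbump;
    try by [congr inord; lia|lia].
    by apply/ord_inj => /=; rewrite inordK //; have := ltn_ord j; lia.
  by apply/ord_inj => /=; rewrite inordK //; have := ltn_ord j; lia.
congr (_ + _); apply: eq_bigr => i _; rewrite mulr_sumr; apply: eq_bigr => k _.
  by rewrite mulrA -exprD /F /prism_piece face_prism; congr (_ * c _); exact: eq_prism.
rewrite mulrA -exprD /K /prism_piece prism_face; congr (_ * c _).
apply: eq_prism => // j; apply/val_inj => /=; rewrite /degeneracy !inordK //;
  have := ltn_ord i; have := ltn_ord k; have := ltn_ord j; rewrite /bump /unbump; lia.
Qed.

Lemma prism_operatorE0 (c : singular R Z 0 -> int) (s : singular R Y 0) :
  c (time_slice 1 \o s) - c (time_slice 0 \o s) = prism_operator (singular_diff c) s.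
Proof.
rewrite -!(prism_ends s) /prism_operator big_ord1 mul1r /singular_diff.
rewrite big_ord_recl big_ord1 expr0 mul1r.
rewrite (_ : (-1) ^+ lift ord0 ord0 = -1 :> int) // mulN1r /prism_piece !face_prism.
by congr (c _ - c _); apply: eq_prism => j; rewrite ?ord1 //= /bump; lia.
Qed.

Lemma prism_operator0 n (s : singular R Y n) : prism_operator 0 s = 0.
Proof. by rewrite /prism_operator big1 // => i _; rewrite mulr0. Qed.

Lemma homotopic_cocycle n (c : singular R Z n.+1 -> int) (s : singular R Y n.+1) :
  singular_diff c = 0 ->
  c (time_slice 1 \o s) = c (time_slice 0 \o s) + singular_diff (prism_operator c) s.
Proof.
move=> dc; have := prism_operatorE c s.
by rewrite dc prism_operator0 add0r => <-; ring.
Qed.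

Lemma homotopic_cocycle0 (c : singular R Z 0 -> int) (s : singular R Y 0) :
  singular_diff c = 0 -> c (time_slice 1 \o s) = c (time_slice 0 \o s).
Proof.
move=> dc; have := prism_operatorE0 c s.
by rewrite dc prism_operator0 => /eqP; rewrite subr_eq0 => /eqP.
Qed.

End Homotopy.

Section Cochains.
Variable R : realType.

Lemma pullback_diff (Y Z : topologicalType) (f : continuousType Y Z) n
    (c : singular R Z n -> int) :
  pullback_cochain f (singular_diff c) = singular_diff (pullback_cochain f c).
Proof. exact: (pullback_cochaind f c). Qed.

Lemma singular_diffB (Y : topologicalType) n (c d : singular R Y n -> int) :
  singular_diff (c - d) = singular_diff c - singular_diff d.
Proof. exact: singular_diff_additive. Qed.

Lemma singular_diffD (Y : topologicalType) n (c d : singular R Y n -> int) :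
  singular_diff (c + d) = singular_diff c + singular_diff d.
Proof. exact: (raddfD (@singular_diff R Y n)). Qed.

Lemma constant_diff (Y : topologicalType) n (v : int) (s : singular R Y n.+1) :
  singular_diff (fun=> v) s = if odd n then v else 0.
Proof.
rewrite /singular_diff -mulr_suml.
have -> : \sum_(i < n.+2) (-1) ^+ i = (odd n)%:R :> int.
  elim: n {s} => [|n IHn]; first by rewrite big_ord_recl big_ord1.
  by rewrite big_ord_recr IHn -signr_odd /=; case: (odd n).
by case: odd; rewrite ?mul1r ?mul0r.
Qed.

End Cochains.

(** * Contractible spaces and products with them *)

Section Contractible.
Variable R : realType.

Definition contractible (E : topologicalType) :=
  exists (h : E * R -> E) (e0 : E),
    [/\ {within setT `*` `[0, 1], continuous h},
        (forall e, h (e, 0) = e) & (forall e, h (e, 1) = e0)].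

Definition clamp (t : R) : R := Num.max 0 (Num.min t 1).

Lemma clamp_continuous : continuous clamp.
Proof.
move=> t; apply: (@continuous_max _ _ (fun=> 0) (fun t : R => Num.min t 1)).
  exact: cst_continuous.
apply: (@continuous_min _ _ id (fun=> 1)); first exact: cvg_id.
exact: cst_continuous.
Qed.

Lemma clamp_itv t : 0 <= clamp t <= 1.
Proof. by rewrite /clamp le_max lexx ge_max ler01 ge_min lexx orbT. Qed.

Lemma clamp0 : clamp 0 = 0.
Proof. by rewrite /clamp (min_idPl (@ler01 R)) maxxx. Qed.

Lemma clamp1 : clamp 1 = 1.
Proof. by rewrite /clamp minxx (max_idPr (@ler01 R)). Qed.

(** Clamping the time to the unit interval makes a contraction continuous on the
whole line, so that homotopies need no restricted domain. *)
Lemma contraction_on_line (E : topologicalType) : contractible E ->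
  exists (h : continuousType (E * R)%type E) (e0 : E),
    (forall e, h (e, 0) = e) /\ (forall e, h (e, 1) = e0).
Proof.
move=> [h [e0 [/subspace_continuousP hc h0 h1]]].
pose h' (p : E * R) := h (p.1, clamp p.2).
have h'c : continuous h'.
  move=> [e t] U /(hc (e, clamp t)) [] /=.
    by split=> //=; rewrite in_itv /= clamp_itv.
  move=> [A B] [/= Ae Bt] AB.
  exists (A, clamp @^-1` B) => /=; first by split => //; exact: clamp_continuous.
  move=> [e' t'] [/= Ae' Bt']; apply: (AB (e', clamp t')) => //.
  by split=> //=; rewrite in_itv /= clamp_itv.
exists (mkcts h'c), e0; split=> e; rewrite /= /mkcts /h' /=; first by rewrite clamp0.
by rewrite clamp1.
Qed.

(** A contraction compares a cocycle with its pullback by a constant map, which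
takes a single value v. On constant cochains d is alternately 0 and the
identity, so v either is 0, the pullback being a cocycle, or is itself the
coboundary of a constant cochain. *)
Lemma contractible_acyclic (E : topologicalType) n (c : singular R E n.+1 -> int) :
  contractible E -> singular_diff c = 0 -> exists b, c = singular_diff b.
Proof.
move=> /contraction_on_line [h [e0 [h0 h1]]] dc.
pose pt m : singular R E m := cst e0.
have ptc : c (pt n.+1) = 0 \/ odd n.
  have := congr1 (fun f => f (pt n.+2)) dc.
  rewrite /singular_diff.
  rewrite (eq_bigr (fun i : 'I__ => (-1) ^+ i * c (pt n.+1))); last first.
    by move=> i _; congr (_ * c _); exact/continuousEP.
  rewrite -/(singular_diff (fun=> c (pt n.+1)) (pt n.+2)) constant_diff /=.
  by case: odd; [right | left].
exists ((fun=> if odd n then c (pt n.+1) else 0) - prism_operator h c).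
apply/funext => s; have := homotopic_cocycle h s dc.
have -> : time_slice h 1 \o s = pt n.+1 :> singular R E n.+1.
  by apply/continuousEP => x; exact: h1.
have -> : time_slice h 0 \o s = s :> singular R E n.+1.
  by apply/continuousEP => x; exact: h0.
move=> ptE; rewrite singular_diffB.
rewrite -[RHS]/(singular_diff (fun=> _) s - singular_diff _ s) constant_diff.
by case: ptc ptE => [->|->] ptE; [case: odd; lia | lia].
Qed.

Lemma contractible_cocycle0 (E : topologicalType) (c : singular R E 0 -> int) :
  contractible E -> singular_diff c = 0 -> forall s t, c s = c t.
Proof.
move=> /contraction_on_line [h [e0 [h0 h1]]] dc.
suff c0 s : c s = c (cst e0 : singular R E 0) by move=> s t; rewrite !c0.
have := homotopic_cocycle0 h s dc.
have -> : time_slice h 1 \o s = cst e0 :> singular R E 0.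
  by apply/continuousEP => x; exact: h1.
have -> : time_slice h 0 \o s = s :> singular R E 0.
  by apply/continuousEP => x; exact: h0.
by move=> ->.
Qed.

End Contractible.

Section ProductWithContractible.
Variables (R : realType) (X E : topologicalType).
Hypothesis E_contractible : contractible R E.

Definition slice (e : E) (x : X) : X * E := (x, e).

Lemma slice_continuous e : continuous (slice e).
Proof. by move=> x; apply: cvg_pair; [exact: cvg_id | exact: cvg_cst]. Qed.
HB.instance Definition _ e := isContinuous.Build _ _ (slice e) (@slice_continuous e).

Definition project (p : X * E) : X := p.1.

Lemma project_continuous : continuous project.
Proof. by move=> p; exact: cvg_fst. Qed.
HB.instance Definition _ := isContinuous.Build _ _ project project_continuous.

Lemma slice_project e n (a : singular R X n -> int) :
  pullback_cochain (slice e) (pullback_cochain project a) = a.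
Proof. by apply/funext => s; congr a; exact/continuousEP. Qed.

Lemma product_contraction :
  exists (K : continuousType (X * E * R)%type (X * E)%type) (e0 : E),
  forall n (s : singular R (X * E)%type n),
    time_slice K 0 \o s = s :> singular R (X * E)%type n /\
    time_slice K 1 \o s = slice e0 \o (project \o s) :> singular R (X * E)%type n.
Proof.
have [h [e0 [h0 h1]]] := contraction_on_line E_contractible.
pose K (p : X * E * R) : X * E := (p.1.1, h (p.1.2, p.2)).
have Kc : continuous K.
  move=> p.
  have p1 : (q.1.1 : X) @[q --> p] --> (p.1.1 : X).
    exact: (@continuous_comp _ (X * E)%type X fst fst p
      (@cvg_fst _ _ _ _ _) (@cvg_fst _ _ _ _ _)).
  have p2 : (q.1.2 : E) @[q --> p] --> (p.1.2 : E).
    exact: (@continuous_comp _ (X * E)%type E fst snd p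
      (@cvg_fst _ _ _ _ _) (@cvg_snd _ _ _ _ _)).
  have p3 : (q.2 : R) @[q --> p] --> (p.2 : R) by exact: cvg_snd.
  apply: (cvg_pair p1).
  apply: (@continuous_comp _ (E * R)%type E (fun q : X * E * R => (q.1.2, q.2)) h).
    exact: (cvg_pair p2 p3).
  exact: cts_fun.
exists (mkcts Kc), e0 => n s; split; apply/continuousEP => x;
  rewrite /= /time_slice /= /mkcts /K /= ?h0 ?h1 //.
by case: (s x).
Qed.

(** Deforming the second coordinate to a point shows that the pullback along the
projection is onto in cohomology. *)
Lemma product_cocycle n (c : singular R (X * E)%type n.+1 -> int) :
  singular_diff c = 0 ->
  exists (a : singular R X n.+1 -> int) b, singular_diff a = 0 /\
    c = pullback_cochain project a + singular_diff b.
Proof.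
move=> dc; have [K [e0 KE]] := product_contraction.
exists (pullback_cochain (slice e0) c), (0 - prism_operator K c); split.
  by rewrite -pullback_diff dc.
apply/funext => s; have := homotopic_cocycle K s dc.
have [-> ->] := KE _ s; rewrite singular_diffB [singular_diff 0]raddf0 sub0r.
change (c (slice e0 \o (project \o s)) = c s + singular_diff (prism_operator K c) s ->
  c s = c (slice e0 \o (project \o s)) - singular_diff (prism_operator K c) s).
lia.
Qed.

Lemma product_cocycle0 (c : singular R (X * E)%type 0 -> int) :
  singular_diff c = 0 ->
  exists2 a : singular R X 0 -> int, singular_diff a = 0 & c = pullback_cochain project a.
Proof.
move=> dc; have [K [e0 KE]] := product_contraction.
exists (pullback_cochain (slice e0) c); first by rewrite -pullback_diff dc.
by apply/funext => s; have := homotopic_cocycle0 K s dc; have [-> ->] := KE _ s => <-.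
Qed.

Lemma slice_exact e n (c : singular R (X * E)%type n.+1 -> int) b :
  singular_diff c = 0 -> pullback_cochain (slice e) c = singular_diff b ->
  exists d, c = singular_diff d.
Proof.
move=> /product_cocycle [a [d [_ ->]]].
rewrite -[LHS]/(pullback_cochain (slice e) (pullback_cochain project a) +
  pullback_cochain (slice e) (singular_diff d)) slice_project pullback_diff => ab.
have -> : a = singular_diff (b - pullback_cochain (slice e) d).
  by rewrite singular_diffB -ab addrK.
exists (pullback_cochain project (b - pullback_cochain (slice e) d) + d).
by rewrite pullback_diff [RHS]singular_diffD.
Qed.

(** All slices induce the inverse of the pullback along the projection. *)
Lemma slices_cohomologous e e' n (c : singular R (X * E)%type n.+1 -> int) :
  singular_diff c = 0 ->
  exists b, pullback_cochain (slice e) c - pullback_cochain (slice e') c = singular_diff b.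
Proof.
move=> /product_cocycle [a [d [_ ->]]].
exists (pullback_cochain (slice e) d - pullback_cochain (slice e') d).
rewrite singular_diffB -!pullback_diff.
pose i u := pullback_cochain (slice u) (pullback_cochain project a).
change (i e + pullback_cochain (slice e) (singular_diff d) -
   (i e' + pullback_cochain (slice e') (singular_diff d)) =
   pullback_cochain (slice e) (singular_diff d) -
   pullback_cochain (slice e') (singular_diff d)).
by rewrite /i !slice_project opprD addrACA subrr add0r.
Qed.

Lemma product_cocycle0_constant :
  (forall g : singular R X 0 -> int, singular_diff g = 0 -> forall s t, g s = g t) ->
  forall g : singular R (X * E)%type 0 -> int,
    singular_diff g = 0 -> forall s t, g s = g t.
Proof. by move=> X0 g /product_cocycle0 [a da ->] s t; exact: X0. Qed.

Lemma product_cocycle1_exact :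
  (forall c : singular R X 1 -> int, singular_diff c = 0 ->
     exists f, c = singular_diff f) ->
  forall c : singular R (X * E)%type 1 -> int, singular_diff c = 0 ->
    exists f, c = singular_diff f.
Proof.
move=> X1 c /product_cocycle [a [b [/X1 [f ->] ->]]].
by exists (pullback_cochain project f + b); rewrite pullback_diff singular_diffD.
Qed.

End ProductWithContractible.

(** * Cocycles of degree zero and one on a connected manifold *)

Section Evaluation.
Variables (R : realType) (X : topologicalType).

Definition eval_cochain n (c : singular R X n -> int) (z : {freeg (singular R X n)}) :
  int := fglift (c : _ -> int^o) z.

Lemma eval_cochain_additive n (c : singular R X n -> int) :
  zmod_morphism (eval_cochain c).
Proof. exact: (@lift_is_additive _ _ int^o c). Qed.
HB.instance Definition _ n (c : singular R X n -> int) := GRing.isZmodMorphism.Build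
  _ _ (eval_cochain c) (@eval_cochain_additive n c).

Lemma eval_cochainU n (c : singular R X n -> int) k s :
  eval_cochain c << k *g s >> = k * c s.
Proof. exact: (@liftU _ int^o _ c k s). Qed.

Lemma eval_cochainZ n (c : singular R X n -> int) k z :
  eval_cochain c (k *: z) = k * eval_cochain c z.
Proof. by rewrite -[k]intz scaler_int raddfMz intz -mulrzl intz. Qed.

Lemma eval_boundary n (c : singular R X n -> int) (z : {freeg (singular R X n.+1)}) :
  eval_cochain c (boundary z) = eval_cochain (singular_diff c) z.
Proof.
elim/freeg_ind_dom0: z => [|k s z _ _ IHz]; first by rewrite !raddf0.
rewrite !raddfD /= IHz eval_cochainU /boundary liftU eval_cochainZ raddf_sum.
congr (_ * _ + _); apply: eq_bigr => i _.
by rewrite /= eval_cochainZ eval_cochainU mul1r.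
Qed.

Lemma eval_zero_cochain n (c : singular R X n -> int) z :
  (forall s, c s = 0) -> eval_cochain c z = 0.
Proof.
move=> c0; elim/freeg_ind_dom0: z => [|k s z _ _ IHz]; first by rewrite raddf0.
by rewrite raddfD /= IHz eval_cochainU c0 mulr0.
Qed.

Lemma boundary1 (s : singular R X 1) :
  boundary << s >> = << face ord0 s >> - << face (lift ord0 ord0) s >>.
Proof.
by rewrite /boundary liftU scale1r big_ord_recl big_ord1 expr0 scale1r scaleN1r.
Qed.

Definition point (x : X) : singular R X 0 := cst x.

Lemma simplex0_eq (u v : stdsimplex R 0) : u = v.
Proof.
have [_ u1] := set_mem (valP u); have [_ v1] := set_mem (valP v).
apply/val_inj/rowP => j; rewrite (ord1 j).
by move: u1 v1; rewrite !big_ord1 => u1 v1; exact: (etrans u1 (esym v1)).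
Qed.

Lemma simplex0P (s : singular R X 0) : exists x, s = point x.
Proof.
have v0 : stdsimplex R 0 (const_mx 1).
  by split=> [i|]; rewrite ?big_ord1 mxE.
pose v : stdsimplex R 0 := exist (fun u => u \in stdsimplex R 0) _ (mem_set v0).
exists (s v); apply/continuousEP => u /=; congr (s _); exact: simplex0_eq.
Qed.

End Evaluation.
Arguments point R {X} x.

Section Linked.
Variables (R : realType) (X : topologicalType).

(** The substitute for being joined by a path: chains can be added, whereas
composing paths would require a reparametrization. *)
Definition linked (x y : X) := exists c : {freeg (singular R X 1)},
  boundary c = << point R y >> - << point R x >>.

Lemma linkedC x y : linked x y -> linked y x.
Proof. by move=> [c cE]; exists (- c); rewrite raddfN /= cE opprB. Qed.

Lemma linked_trans x y z : linked x y -> linked y z -> linked x z.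
Proof.
by move=> [c cE] [d dE]; exists (d + c); rewrite raddfD /= cE dE addrA subrK.
Qed.

Hypothesis X_linked : forall x y, linked x y.

Lemma cocycle0_constant (g : singular R X 0 -> int) :
  singular_diff g = 0 -> forall s t, g s = g t.
Proof.
move=> dg s t; have [x ->] := simplex0P s; have [y ->] := simplex0P t.
have [c cE] := X_linked y x.
have := eval_boundary g c.
rewrite dg cE raddfB /= !eval_cochainU !mul1r eval_zero_cochain //.
by move=> /eqP; rewrite subr_eq0 => /eqP.
Qed.

(** A primitive at x is the value of c on a chain from the base point to x. *)
Lemma cocycle1_exact (x0 : X) (c : singular R X 1 -> int) :
  (forall z, z \in @singular_cycle R X 1 -> eval_cochain c z = 0) ->
  exists b, c = singular_diff b.
Proof.
move=> c0; have /choice[path pathE] := X_linked x0.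
have Xpt (s : singular R X 0) : exists x, s == point R x.
  by have [x ->] := simplex0P s; exists x.
pose end_of s := xchoose (Xpt s).
have end_ofK s : point R (end_of s) = s by apply/esym/eqP/(xchooseP (Xpt s)).
exists (fun s => eval_cochain c (path (end_of s))); apply/funext => s.
rewrite /singular_diff big_ord_recl big_ord1 expr0 mul1r.
rewrite (_ : (-1) ^+ lift ord0 ord0 = -1 :> int) // mulN1r.
rewrite -raddfB /=; apply/eqP.
rewrite -[c s]mul1r -eval_cochainU -subr_eq0 -raddfB /=; apply/eqP/c0.
rewrite inE !raddfB /= boundary1 !pathE !end_ofK.
by rewrite opprK opprB [X in _ + X]addrC !subrKA subrr.
Qed.

(** If H_1 has rank zero then every 1-cycle z has a nonzero multiple that is a
boundary, on which a cocycle vanishes; it vanishes on z as Z is torsion free. *)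
Lemma betti1_0_cocycle1_exact (x0 : X) (c : singular R X 1 -> int) :
  has_betti R X 1 0 -> singular_diff c = 0 -> exists b, c = singular_diff b.
Proof.
move=> [_ rk] dc; apply: (cocycle1_exact x0) => z zZ.
pose w : singular_homology R X 1 := \pi_(singular_homology R X 1) (Cycle zZ).
have [k [k0 wk]] : exists k : int, k <> 0 /\ w *~ k = 0.
  apply: contrapT => nok; suff /rk : zfree (fun _ : 'I_1 => w) by [].
  move=> k; rewrite big_ord1 => wk i; rewrite ord1; apply: contrapT => k0.
  by apply: nok; exists (k ord0).
have zk : z *~ k \in @singular_boundary R X 1.
  move: wk; rewrite /w -raddfMz -[RHS](raddf0 \pi_(singular_homology R X 1)) => /eqP.
  by rewrite -Quotient.idealrBE subr0 boundingE raddfMz.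
move: zk => /asboolP [u zu].
have : eval_cochain c z * k = 0.
  by rewrite -mulrzz -raddfMz /= zu eval_boundary dc; exact: eval_zero_cochain.
by move=> /eqP; rewrite mulf_eq0 => /orP[/eqP//|/eqP].
Qed.

End Linked.

Section ManifoldPaths.
Variables (R : realType) (X : topologicalType).

Lemma chart_segment_linked n (c : chart R X n) x y :
  chart_dom c x -> chart_dom c y ->
  (forall a b : R, 0 <= a -> 0 <= b -> a + b = 1 ->
     chart_cod c (a *: chart_to c x + b *: chart_to c y)) ->
  linked R x y.
Proof.
move=> xc yc seg; pose v1 : 'I_2 := lift ord0 ord0.
pose g (u : stdsimplex R 1) :=
  \val u 0 ord0 *: chart_to c x + \val u 0 v1 *: chart_to c y.
have gcod u : chart_cod c (g u).
  have [u0 u1] := set_mem (valP u); apply: seg => //.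
  by rewrite -[RHS]u1 big_ord_recl big_ord1.
have gc : continuous g.
  move=> u; apply: continuous_row => j.
  rewrite (_ : (fun _ => _) = fun v : stdsimplex R 1 =>
    \val v 0 ord0 * chart_to c x 0 j + \val v 0 v1 * chart_to c y 0 j); last first.
    by apply/funext => v; rewrite !mxE.
  have scaled (i : 'I_2) (a : R) :
      {for u, continuous (fun v : stdsimplex R 1 => (\val v 0 i : R) * a)}.
    apply: (@continuousM _ _ (fun v : stdsimplex R 1 => \val v 0 i : R) (fun=> a)).
      exact: barycentric_continuous.
    exact: cst_continuous.
  exact: (cvgD (scaled _ _) (scaled _ _)).
pose s u := chart_from c (g u).
have sc : continuous s.
  move=> u; apply: continuous_comp; first exact: gc.
  by apply: chart_from_continuous; apply: mem_set.
exists << (mkcts sc : singular R X 1) >>; rewrite boundary1.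
have vertex (i : 'I_2) (u : stdsimplex R 0) : \val (coface i u) 0 i = 0.
  by rewrite mxE unlift_none.
have vertex' (i : 'I_2) (k : 'I_1) (u : stdsimplex R 0) :
    \val (coface i u) 0 (lift i k) = 1.
  by rewrite mxE liftK; have [_ <-] := set_mem (valP u); rewrite big_ord1 (ord1 k).
congr (<< _ >> - << _ >>); apply/continuousEP => u; rewrite /= /mkcts /s /g.
  rewrite vertex vertex' scale0r add0r scale1r; apply: chart_toK; exact: mem_set.
rewrite vertex (_ : ord0 = lift v1 ord0); last exact/val_inj.
rewrite vertex' scale0r addr0 scale1r; apply: chart_toK; exact: mem_set.
Qed.

(** Balls being convex, a small ball in the chart contains the segments that join
its points to its centre. *)
Lemma locally_linked n (c : chart R X n) x : chart_dom c x ->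
  \forall y \near x, linked R x y.
Proof.
move=> xc; have xcod := chart_to_cod xc.
have := open_nbhs_nbhs (conj (@chart_cod_open _ _ _ c) xcod).
move=> /nbhs_ballP[r /= r0 rsub].
have xdom := open_nbhs_nbhs (conj (@chart_dom_open _ _ _ c) xc).
have xball : \forall y \near x, ball (chart_to c x) r (chart_to c y).
  have := chart_to_continuous (mem_set xc : x \in chart_dom c); apply.
  exact: nbhsx_ballx.
apply: filterS2 xdom xball => y yc yr.
apply: chart_segment_linked xc yc _ => a b a0 b0 ab; apply: rsub.
move: yr; rewrite -ball_normE /ball_ /= => yr.
rewrite (_ : _ - _ = b *: (chart_to c x - chart_to c y)); last first.
  by rewrite -[X in X - _]scale1r -ab scalerDl opprD addrACA subrr add0r scalerBr.
rewrite normrZ ger0_norm //; apply: le_lt_trans yr.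
by rewrite ler_piMl // -ab lerDr.
Qed.

End ManifoldPaths.

(** Equivalence classes are open, hence also closed. *)
Lemma connected_local_equivalence (T : topologicalType) (r : T -> T -> Prop) :
  (forall x y, r x y -> r y x) -> (forall x y z, r x y -> r y z -> r x z) ->
  (forall x, \forall y \near x, r x y) ->
  connected [set: T] -> forall x y, r x y.
Proof.
move=> rC rT rN Tc x y.
have ro (P : T -> Prop) : (forall y z, r y z -> P y -> P z) -> open [set z | P z].
  move=> Pr; rewrite openE => z /= Pz; apply: filterS (rN z) => w zw.
  exact: Pr zw Pz.
suff : [set z | r x z] = setT by move=> xT; have : [set: T] y by []; rewrite -xT.
apply: Tc.
- exists x; exact: nbhs_singleton (rN x).
- exists [set z | r x z]; last by rewrite setTI.
  by apply: ro => u v uv xu; exact: rT xu uv.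
- exists [set z | r x z]; last by rewrite setTI.
  rewrite -openC; apply: (ro (fun z => ~ r x z)) => u v uv xu xv; apply: xu.
  exact: rT xv (rC _ _ uv).
Qed.

Lemma manifold_linked (R : realType) n (M : orientedManifold R n) :
  connected [set: M] -> forall x y : M, linked R x y.
Proof.
apply: connected_local_equivalence.
- exact: linkedC.
- exact: linked_trans.
- by move=> x; have [c _ xc] := atlas_cover x; exact: locally_linked xc.
Qed.

(** * Cochains under a free involution *)

(** D holds at the element of its orbit that the choice operator selects. *)
Lemma free_involution_halves (T : choiceType) (t : T -> T) :
  involutive t -> (forall x, t x != x) ->
  exists D : pred T, forall x, D (t x) = ~~ D x.
Proof.
move=> tK tx; pose r x := choose (pred2 x (t x)) x.
have rt x : r (t x) = r x.
  rewrite /r (@eq_choose _ _ (pred2 x (t x))); last first.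
    by move=> y /=; rewrite tK orbC.
  by apply: choose_id; rewrite /= eqxx ?orbT.
exists (fun x => r x == x) => x; rewrite rt.
have /orP[/eqP ->|/eqP ->] : pred2 x (t x) (r x) by apply: chooseP; rewrite /= eqxx.
  by rewrite eqxx eq_sym (negbTE (tx x)).
by rewrite eqxx (negbTE (tx x)).
Qed.

Section FreeInvolution.
Variables (R : realType) (Y : topologicalType) (tau : continuousType Y Y).
Hypothesis tauK : involutive tau.

Local Notation C n := (singular R Y n -> int).
Local Notation T := (pullback_cochain tau).

Lemma pullback_involutionK n (c : C n) : T (T c) = c.
Proof.
by apply/funext => s; congr c; apply/continuousEP => x; rewrite /= tauK.
Qed.

Lemma pullback_sum_orbit n (c : C n) : T (c + T c) = c + T c.
Proof. by rewrite -[LHS]/(T c + T (T c)) pullback_involutionK addrC. Qed.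

Hypothesis tau_free : forall y, tau y <> y.

Lemma simplex_halves n : exists D : pred (singular R Y n),
  forall s : singular R Y n, D (tau \o s) = ~~ D s.
Proof.
have v0 : stdsimplex R n (\row_j (j == ord0)%:R).
  split=> [i|]; first by rewrite mxE ler0n.
  rewrite (bigD1 ord0) //= mxE eqxx big1 ?addr0 // => i i0.
  by rewrite mxE (negbTE i0).
pose v : stdsimplex R n := exist (fun u => u \in stdsimplex R n) _ (mem_set v0).
apply: (@free_involution_halves _ (fun s : singular R Y n => tau \o s)).
  by move=> s; apply/continuousEP => x; rewrite /= tauK.
move=> s; apply/eqP => /continuousEP /(_ v); exact: tau_free.
Qed.

Lemma invariant_norm n (b : C n) : T b = b -> exists a : C n, b = a + T a.
Proof.
move=> Tb; have [D tD] := simplex_halves n.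
exists (fun s => if D s then b s else 0); apply/funext => s.
rewrite -[RHS]/((if D s then b s else 0) + (if D (tau \o s) then T b s else 0)).
by rewrite Tb tD; case: (D s); rewrite ?addr0 ?add0r.
Qed.

Lemma antiinvariant_norm n (b : C n) : T b = - b -> exists a : C n, b = a - T a.
Proof.
move=> Tb; have [D tD] := simplex_halves n.
exists (fun s => if D s then b s else 0); apply/funext => s.
rewrite -[RHS]/((if D s then b s else 0) - (if D (tau \o s) then T b s else 0)).
by rewrite Tb tD; case: (D s); rewrite ?subr0 // sub0r opprK.
Qed.

Hypothesis cocycle0_cst :
  forall g : C 0, singular_diff g = 0 -> forall s t, g s = g t.
Hypothesis cocycle1_ex :
  forall c : C 1, singular_diff c = 0 -> exists f, c = singular_diff f.

(** The obstruction to making a primitive anti-invariant is the constant g - T g,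
and it vanishes because the integers have no 2-torsion. *)
Lemma antiinvariant_primitive (c : C 2) (b : C 1) :
  T c = - c -> c = singular_diff b ->
  exists2 b' : C 1, T b' = - b' & c = singular_diff b'.
Proof.
move=> Tc cb.
have [g bg] : exists g, b + T b = singular_diff g.
  by apply: cocycle1_ex; rewrite singular_diffD -pullback_diff -cb Tc subrr.
have Tg : T g = g.
  have dTg : singular_diff (g - T g) = 0.
    by rewrite singular_diffB -pullback_diff -bg pullback_sum_orbit subrr.
  apply/funext => s.
  have := cocycle0_cst dTg s (tau \o s).
  rewrite -[LHS]/(g s - T g s) -[RHS]/(T g s - T (T g) s) pullback_involutionK.
  lia.
have [f gf] := invariant_norm Tg.
exists (b - singular_diff f).
  rewrite -[LHS]/(T b - T (singular_diff f)) pullback_diff.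
  move: bg; rewrite gf singular_diffD => bg.
  apply/funext => s.
  have : b s + T b s = singular_diff f s + singular_diff (T f) s.
    by rewrite -[LHS]/((b + T b) s) bg.
  change (b s + T b s = singular_diff f s + singular_diff (T f) s ->
    T b s - singular_diff (T f) s = - (b s - singular_diff f s)).
  lia.
by rewrite singular_diffB singular_diffK subr0.
Qed.

Section EquivariantPoint.
Variables (E : topologicalType) (tauE : continuousType E E) (j : continuousType E Y).
Hypothesis E_contractible : contractible R E.
Hypothesis tauEK : involutive tauE.
Hypothesis j_equivariant : forall x, j (tauE x) = tau (j x).

Local Notation J := (pullback_cochain j).
Local Notation TE := (pullback_cochain tauE).

Lemma pullback_equivariant n (c : C n) : J (T c) = TE (J c).
Proof.
by apply/funext => s; congr c; apply/continuousEP => x; rewrite /= j_equivariant.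
Qed.

(** Over E, where all cocycles of positive degree are exact, the restriction of c
is d a and that of b - (a + T a) is d f. Hence the restriction of g differs from
f - T f by a constant m, and g + T g restricts to the constant m + m. *)
Lemma equivariant_point_parity (e : E) (c : C 2) (b : C 1) (g : C 0) :
  singular_diff c = 0 -> c + T c = singular_diff b -> b - T b = singular_diff g ->
  exists m : int, forall s, g s + T g s = m + m.
Proof.
move=> dc cb bg.
have TEK n (u : singular R E n -> int) : TE (TE u) = u.
  by apply/funext => s; congr u; apply/continuousEP => x; rewrite /= tauEK.
have [a ca] : exists a, J c = singular_diff a.
  by apply: (contractible_acyclic E_contractible); rewrite -pullback_diff dc.
have [f bf] : exists f, J b - (a + TE a) = singular_diff f.
  apply: (contractible_acyclic E_contractible).
  rewrite singular_diffB singular_diffD -!pullback_diff -ca -cb.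
  by rewrite -[J (c + T c)]/(J c + J (T c)) pullback_equivariant subrr.
have dgf : singular_diff (J g - (f - TE f)) = 0.
  rewrite !singular_diffB -!pullback_diff -bg -bf.
  rewrite -[J (b - T b)]/(J b - J (T b)) pullback_equivariant.
  rewrite -[TE (J b - (a + TE a))]/(TE (J b) - (TE a + TE (TE a))) TEK.
  by apply/eqP; rewrite subr_eq0 [TE a + a]addrC opprB subrKA.
have gT : singular_diff (g + T g) = 0.
  rewrite singular_diffD -pullback_diff -bg.
  rewrite -[T (b - T b)]/(T b - T (T b)) pullback_involutionK.
  by rewrite addrA subrK subrr.
pose s0 : singular R E 0 := cst e.
exists (J g s0 - (f s0 - TE f s0)) => s.
have := cocycle0_cst gT s (j \o s0).
have := contractible_cocycle0 E_contractible dgf (tauE \o s0) s0.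
change (TE (J g) s0 - (TE f s0 - TE (TE f) s0) = J g s0 - (f s0 - TE f s0) ->
  g s + T g s = J g s0 + J (T g) s0 ->
  g s + T g s = J g s0 - (f s0 - TE f s0) + (J g s0 - (f s0 - TE f s0))).
rewrite TEK pullback_equivariant; lia.
Qed.

Lemma antiinvariant_representative (e : E) (c : C 2) (b : C 1) :
  singular_diff c = 0 -> c + T c = singular_diff b ->
  exists a : C 1, T (c - singular_diff a) = - (c - singular_diff a).
Proof.
move=> dc cb.
have [g bg] : exists g, b - T b = singular_diff g.
  apply: cocycle1_ex.
  by rewrite singular_diffB -pullback_diff -cb pullback_sum_orbit subrr.
have [m gm] := equivariant_point_parity e dc cb bg.
have [f gf] : exists f : C 0, (fun s => g s - m) = f - T f.
  apply: antiinvariant_norm; apply/funext => s; have := gm s.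
  change (g s + T g s = m + m -> T g s - m = - (g s - m)); lia.
have {}bg : b - T b = singular_diff f - T (singular_diff f).
  rewrite pullback_diff -singular_diffB -gf bg.
  rewrite -[fun s => _]/(g - (fun=> m)) singular_diffB; apply/funext => s.
  rewrite -[RHS]/(singular_diff g s - singular_diff (fun=> m) s).
  by rewrite constant_diff subr0.
have [a ba] : exists a : C 1, b - singular_diff f = a + T a.
  apply: invariant_norm; apply/funext => s.
  have : b s - T b s = singular_diff f s - T (singular_diff f) s.
    by rewrite -[LHS]/((b - T b) s) bg.
  change (b s - T b s = singular_diff f s - T (singular_diff f) s ->
    T b s - T (singular_diff f) s = b s - singular_diff f s); lia.
exists a; apply/funext => s.
have : c s + T c s = singular_diff a s + T (singular_diff a) s.
  rewrite -[LHS]/((c + T c) s) cb.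
  rewrite -[RHS]/((singular_diff a + T (singular_diff a)) s).
  by rewrite pullback_diff -singular_diffD -ba singular_diffB singular_diffK subr0.
change (c s + T c s = singular_diff a s + T (singular_diff a) s ->
  T c s - T (singular_diff a) s = - (c s - singular_diff a s)); lia.
Qed.

End EquivariantPoint.

End FreeInvolution.

(** * The forgetful map *)

Lemma class_eqP (C : cochainComplex) n (z z' : cycle_of (@cocycle C n.+1)) :
  (\pi_(cohomology C n.+1) z = \pi_(cohomology C n.+1) z') <->
  exists b, val z - val z' = codiff C n b.
Proof.
have E : (\pi_(cohomology C n.+1) z == \pi_(cohomology C n.+1) z') =
         (val z - val z' \in @coboundary C n.+1).
  by rewrite -Quotient.idealrBE boundingE raddfB.
by split=> [/eqP|h]; [rewrite E => /asboolP | apply/eqP; rewrite E; apply/asboolP].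
Qed.

Lemma class_cocycle (C : cochainComplex) n (x : cohomology C n) :
  exists z : cycle_of (@cocycle C n), x = \pi_(cohomology C n) z.
Proof. by exists (repr x); rewrite reprK. Qed.

Lemma twisted_cocycle (R : realType) (Y : topologicalType) (tau : continuousType Y Y)
    n (z : cycle_of (@cocycle (twisted_cochains R tau) n)) :
  singular_diff (twisted_val (val z)) = 0.
Proof. by have := cycle_valP z; rewrite inE => /eqP/eqP. Qed.

Lemma antipode_neq (R : realType) (E : universalZ2 R) (e : E) : antipode e <> e.
Proof.
have [U [_ Ue] U0] := antipode_free e => ee.
suff : (U `&` @antipode R E @^-1` U) e by rewrite U0.
by split=> //=; rewrite ee.
Qed.

Section Forgetful.
Variables (R : realType) (X : orientedManifold R 4) (sigma : realStructure X).
Variables (E : universalZ2 R) (e : E).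

Local Notation Y := (X * E)%type.
Local Notation tau := (@diagonal_involution R X sigma E).

Lemma borel_restrictionE n (c : borel_cochains sigma E n) :
  borel_restriction e c = pullback_cochain (slice e) (twisted_val c).
Proof. by apply/funext => s; congr (twisted_val c); apply/continuousEP. Qed.

Let E_contractible : contractible R E := EZ2_contractible E.

(** On an anti-invariant c, the pullback by sigma of the restriction to the slice
of e is minus the restriction to the slice of the antipode of e; and any two
slices give cohomologous restrictions. *)
Lemma forgetful_antiinvariant (x : cohomology (borel_cochains sigma E) 2) :
  pullback R sigma 2 (forgetful sigma e 2 x) = - forgetful sigma e 2 x.
Proof.
have [z ->] := class_cocycle x.
rewrite /pullback /forgetful !cohomology_mapE -raddfN; apply/(@class_eqP _ 1).
pose c := twisted_val (val z).
have dc : singular_diff c = 0 by exact: twisted_cocycle.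
have [b bE] := slices_cohomologous E_contractible e (antipode e) dc.
exists b; rewrite -[RHS]bE.
rewrite -[LHS]/(pullback_cochain sigma (borel_restriction e (val z)) -
  - borel_restriction e (val z)) borel_restrictionE.
apply/funext => s.
have /asboolP/(_ (slice (antipode e) \o s)) := twisted_valP (val z).
have -> : tau \o (slice (antipode e) \o s) = slice e \o (sigma \o s) :> singular R Y 2.
  by apply/continuousEP => u; rewrite /= /diagonal_involution /= antipodeK.
change (c (slice e \o (sigma \o s)) = - c (slice (antipode e) \o s) ->
  c (slice e \o (sigma \o s)) - - c (slice e \o s) =
  c (slice e \o s) - c (slice (antipode e) \o s)).
lia.
Qed.

Let tauK : involutive tau.
Proof. by move=> [x u]; rewrite /= /diagonal_involution /= involutionK antipodeK. Qed.

Let tau_free y : tau y <> y.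
Proof. by case: y => x u [_]; exact: antipode_neq. Qed.

Hypothesis cocycle0_cst : forall g : singular R Y 0 -> int,
  singular_diff g = 0 -> forall s t, g s = g t.
Hypothesis cocycle1_ex : forall c : singular R Y 1 -> int,
  singular_diff c = 0 -> exists f, c = singular_diff f.

Lemma forgetful_injective : injective (forgetful sigma e 2).
Proof.
move=> x y; have [z ->] := class_cocycle x; have [w ->] := class_cocycle y.
rewrite /forgetful !cohomology_mapE => /(@class_eqP _ 1) [b /= zwb].
apply: (proj2 (@class_eqP _ 1 z w)).
pose c := val z - val w.
have dc : singular_diff (twisted_val c) = 0 by exact: (twisted_cocycle (z - w)).
have ce : pullback_cochain (slice e) (twisted_val c) = singular_diff b.
  by rewrite -zwb -(borel_restrictionE c) raddfB.
have [d cd] := slice_exact E_contractible dc ce.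
have Tc : pullback_cochain tau (twisted_val c) = - twisted_val c.
  by apply/funext => s; have /asboolP := twisted_valP c; apply.
have [d' Td' cd'] := antiinvariant_primitive tauK tau_free cocycle0_cst cocycle1_ex Tc cd.
have d'P : d' \in @antiinvariant R _ tau 1.
  by apply/asboolP => s; rewrite -[LHS]/(pullback_cochain tau d' s) Td'.
exists (TwistedCochain d'P); apply/val_inj; exact: cd'.
Qed.

Lemma antiinvariant_class_lifts (x0 : X) (alpha : cohomology (singular_cochains R X) 2) :
  sigma x0 = x0 -> pullback R sigma 2 alpha = - alpha ->
  range (forgetful sigma e 2) alpha.
Proof.
move=> sx0; have [z ->] := class_cocycle alpha.
rewrite /pullback cohomology_mapE -raddfN => /(@class_eqP _ 1) [b zb].
pose a : singular R X 2 -> int := val z.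
have da : singular_diff a = 0 by apply/eqP; exact: (cycle_valP z).
pose c := pullback_cochain (@project X E) a.
have dc : singular_diff c = 0 by rewrite -pullback_diff da.
have cb : c + pullback_cochain tau c =
    singular_diff (pullback_cochain (@project X E) b).
  rewrite -pullback_diff -[singular_diff b]zb; apply/funext => s.
  change (c s + a (@project X E \o (tau \o s)) =
    a (sigma \o (@project X E \o s)) - - c s).
  have -> : @project X E \o (tau \o s) = sigma \o (@project X E \o s) :> singular R X 2.
    exact/continuousEP.
  lia.
have jc : continuous (fun u : E => (x0, u)).
  by move=> u; apply: cvg_pair; [exact: cvg_cst | exact: cvg_id].
pose j : continuousType E Y := mkcts jc.
pose tauE : continuousType E E := mkcts (@antipode_continuous R E).
have jtau u : j (tauE u) = tau (j u).
  by rewrite /= /mkcts /diagonal_involution /= sx0.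
have [d cd] := antiinvariant_representative tauK tau_free cocycle0_cst cocycle1_ex
  E_contractible (@antipodeK R E : involutive tauE) jtau e dc cb.
have cdP : c - singular_diff d \in @antiinvariant R _ tau 2.
  apply/asboolP => s.
  by rewrite -[LHS]/(pullback_cochain tau (c - singular_diff d) s) cd.
have cdZ : TwistedCochain cdP \in @cocycle (borel_cochains sigma E) 2.
  by rewrite inE; apply/eqP; rewrite /= singular_diffB dc singular_diffK subr0.
exists (\pi_(cohomology _ 2) (Cycle cdZ)) => //.
rewrite /forgetful cohomology_mapE; apply/(@class_eqP _ 1).
exists (- pullback_cochain (slice e) d).
rewrite raddfN -[codiff _ _ _]/(singular_diff (pullback_cochain (slice e) d)).
rewrite -pullback_diff.
rewrite -[LHS]/(borel_restriction e (TwistedCochain cdP) - a) borel_restrictionE.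
rewrite -[LHS]/(pullback_cochain (slice e) c -
  pullback_cochain (slice e) (singular_diff d) - a).
by rewrite slice_project addrAC subrr sub0r.
Qed.

End Forgetful.

Unset Implicit Arguments.

Theorem theorem1p2 (R : realType) (X : orientedManifold R 4)
    (sigma : realStructure X) (E : universalZ2 R) (e : E) :
  compact [set: X] ->
  connected [set: X] ->
  has_betti R X 1 0 ->
  (exists x : X, sigma x = x) ->
  injective (forgetful sigma e 2) /\
  range (forgetful sigma e 2) =
    [set alpha : cohomology (singular_cochains R X) 2 |
      pullback R sigma 2 alpha = - alpha].
Proof.
move=> _ X_connected b1 [x0 sx0].
have X_linked := manifold_linked X_connected.
have Ec : contractible R E := EZ2_contractible E.
have Y0 := product_cocycle0_constant Ec (cocycle0_constant X_linked).
have Y1 := product_cocycle1_exact Ec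
  (fun c => betti1_0_cocycle1_exact X_linked x0 (c := c) b1).
split; first exact: forgetful_injective Y0 Y1.
apply/seteqP; split=> alpha; last exact: (antiinvariant_class_lifts e Y0 Y1 sx0).
by move=> [x _ <-]; exact: forgetful_antiinvariant.
Qed.
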